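(* Let $R$ be an algebraic curvature tensor on a Euclidean vector space $V$ of dimension $n\geq 4$. If $$R_{1313}+R_{1414}+R_{2323}+R_{2424} > \tfrac12\left(R_{1212}+R_{3434}\right)$$ for all orthonormal four-frames $\{e_1,e_2,e_3,e_4\}\subset V$, then $R$ has positive isotropic curvature, i.e. $$R_{1313}+R_{1414}+R_{2323}+R_{2424}-2R_{1234}>0$$ for all orthonormal four-frames $\{e_1,e_2,e_3,e_4\}\subset V$.
   Context: An algebraic curvature tensor on $V$ is a 4-linear form $R:V^4\to\mathbb{R}$ satisfying $R(X,Y,Z,W)=-R(Y,X,Z,W)=-R(X,Y,W,Z)=R(Z,W,X,Y)$ and the first Bianchi identity $R(X,Y,Z,W)+R(X,Z,W,Y)+R(X,W,Y,Z)=0$ for all $X,Y,Z,W\in V$. For an orthonormal frame $\{e_i\}$, $R_{ijkl}=R(e_i,e_j,e_k,e_l)$; thus $R_{ijij}$ is the sectional curvature of the plane spanned by $e_i,e_j$. *)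

(* Defs.v *)
From mathcomp Require Import all_boot all_order all_algebra.
From mathcomp Require Import sesquilinear reals.

Set Implicit Arguments.
Unset Strict Implicit.
Unset Printing Implicit Defensive.

Import Order.TTheory GRing.Theory Num.Theory.
Local Open Scope ring_scope.

(* A Euclidean space is a finite-dimensional real vector space [V : vectType K]
   with an inner product [g : {dot V for idfun}]: with [idfun] as the
   conjugation, such forms are bilinear, symmetric and positive definite. *)

Definition four_linear (K : realType) (V : vectType K)
    (R : V -> V -> V -> V -> K) : Prop :=
  [/\ forall Y Z W : V, scalar (fun X : V => R X Y Z W),
      forall X Z W : V, scalar (fun Y : V => R X Y Z W),
      forall X Y W : V, scalar (fun Z : V => R X Y Z W) &
      forall X Y Z : V, scalar (fun W : V => R X Y Z W)].

Record algebraic_curvature_tensor (K : realType) (V : vectType K)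
    (R : V -> V -> V -> V -> K) : Prop := AlgebraicCurvatureTensor {
  act_four_linear : four_linear R;
  act_antisym12 : forall X Y Z W : V, R X Y Z W = - R Y X Z W;
  act_antisym34 : forall X Y Z W : V, R X Y Z W = - R X Y W Z;
  act_pair_sym : forall X Y Z W : V, R X Y Z W = R Z W X Y;
  act_bianchi : forall X Y Z W : V, R X Y Z W + R X Z W Y + R X W Y Z = 0
}.

Definition positive_isotropic_curvature (K : realType) (V : vectType K)
    (g : {dot V for idfun}) (R : V -> V -> V -> V -> K) : Prop :=
  forall e1 e2 e3 e4 : V, orthonormal g [:: e1; e2; e3; e4] ->
    R e1 e3 e1 e3 + R e1 e4 e1 e4 + R e2 e3 e2 e3 + R e2 e4 e2 e4
      - 2 * R e1 e2 e3 e4 > 0.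

(* Main.v *)
Require Import Defs.
From mathcomp Require Import all_boot all_order all_algebra.
From mathcomp Require Import sesquilinear reals.
From mathcomp Require Import lra.

Set Implicit Arguments.
Unset Strict Implicit.
Unset Printing Implicit Defensive.

Import Order.TTheory GRing.Theory Num.Theory.
Local Open Scope ring_scope.

(** On the span of a four-frame, the curvature operator has blocks [A], [C] on
    the self-dual and anti-self-dual two-forms, and Bianchi gives tr A = tr C.
    With w = (e12 + e34) / sqrt 2, the isotropic curvature of the frame is
    2 (tr A - A(w, w)), while the hypothesis reads
    tr A + tr C > 3/2 (A(w, w) + C(v, v)) with v = (e12 - e34) / sqrt 2.
    Summing the hypothesis over three frames which share w, and whose v form an
    orthonormal basis of the anti-self-dual forms, replaces C(v, v) by tr C and
    leaves 9/2 (tr A - A(w, w)) > 0. *)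

Lemma orthonormal4P (K : realType) (V : vectType K) (g : {dot V for idfun})
    (a b c d : V) :
  reflect [/\ [/\ g a a = 1, g b b = 1, g c c = 1 & g d d = 1],
              [/\ g a b = 0, g a c = 0 & g a d = 0] &
              [/\ g b c = 0, g b d = 0 & g c d = 0]]
          (orthonormal g [:: a; b; c; d]).
Proof.
rewrite /orthonormal /= !andbT -!andbA.
apply: (iffP idP) => [|[[-> -> -> ->] [-> -> ->] [-> -> ->]]]; last first.
  by rewrite !eqxx.
by do 9![case/andP=> /eqP->]; move=> /eqP->.
Qed.

Lemma dot_sym (K : realType) (V : vectType K) (g : {dot V for idfun})
    (u v : V) : g u v = g v u.
Proof. by rewrite hermC /= expr0 mul1r. Qed.

Lemma dotDl (K : realType) (V : vectType K) (g : {dot V for idfun})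
    (u v w : V) : g (u + v) w = g u w + g v w.
Proof. exact: linearDl. Qed.

Lemma dotZl (K : realType) (V : vectType K) (g : {dot V for idfun})
    (c : K) (u w : V) : g (c *: u) w = c * g u w.
Proof. exact: linearZl_LR. Qed.

Lemma dotNl (K : realType) (V : vectType K) (g : {dot V for idfun})
    (u w : V) : g (- u) w = - g u w.
Proof. by rewrite -scaleN1r dotZl mulN1r. Qed.

Lemma dotDr (K : realType) (V : vectType K) (g : {dot V for idfun})
    (u v w : V) : g u (v + w) = g u v + g u w.
Proof. by rewrite !(dot_sym g u) dotDl. Qed.

Lemma dotZr (K : realType) (V : vectType K) (g : {dot V for idfun})
    (c : K) (u w : V) : g u (c *: w) = c * g u w.
Proof. by rewrite !(dot_sym g u) dotZl. Qed.

Lemma dotNr (K : realType) (V : vectType K) (g : {dot V for idfun})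
    (u w : V) : g u (- w) = - g u w.
Proof. by rewrite !(dot_sym g u) dotNl. Qed.

(* The new frame has the same e12 + e34, and e13 + e24 becomes e14 - e23. *)
Lemma orthonormal4_turn (K : realType) (V : vectType K)
    (g : {dot V for idfun}) (e1 e2 e3 e4 : V) :
  orthonormal g [:: e1; e2; e3; e4] -> orthonormal g [:: e1; e2; e4; - e3].
Proof.
move=> /orthonormal4P[[n1 n2 n3 n4] [o12 o13 o14] [o23 o24 o34]].
apply/orthonormal4P; rewrite !(dotNl, dotNr) (dot_sym g e4 e3).
by rewrite n1 n2 n3 n4 o12 o13 o14 o23 o24 o34 oppr0 opprK.
Qed.

(* The new frame has the same e12 + e34, and its e12 - e34 is the old
   e13 + e24. *)
Lemma orthonormal4_mix (K : realType) (V : vectType K)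
    (g : {dot V for idfun}) (c : K) (e1 e2 e3 e4 : V) :
  c * c = 2^-1 -> orthonormal g [:: e1; e2; e3; e4] ->
  orthonormal g [:: c *: (e1 - e4); c *: (e2 + e3);
                    c *: (e1 + e4); c *: (e2 - e3)].
Proof.
move=> cc /orthonormal4P[[n1 n2 n3 n4] [o12 o13 o14] [o23 o24 o34]].
apply/orthonormal4P; rewrite !(dotZl, dotZr).
rewrite !(dotDl, dotDr, dotNl, dotNr).
rewrite (dot_sym g e4 e1) (dot_sym g e4 e2) (dot_sym g e4 e3).
rewrite (dot_sym g e3 e1) (dot_sym g e3 e2) (dot_sym g e2 e1).
rewrite n1 n2 n3 n4 o12 o13 o14 o23 o24 o34.
by split; split; rewrite ?mulrA ?cc; lra.
Qed.

Section CurvatureTensor.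

Variables (K : realType) (V : vectType K) (R : V -> V -> V -> V -> K).
Hypothesis curvR : algebraic_curvature_tensor R.

Lemma act_add1 (X X' Y Z W : V) : R (X + X') Y Z W = R X Y Z W + R X' Y Z W.
Proof.
have [l _ _ _] := act_four_linear curvR.
by have := l Y Z W 1 X X'; rewrite scale1r mul1r.
Qed.

Lemma act_scale1 (c : K) (X Y Z W : V) : R (c *: X) Y Z W = c * R X Y Z W.
Proof.
have [l _ _ _] := act_four_linear curvR; have := l Y Z W c X 0.
(* With scalar -1 at zero vectors the right-hand side cancels, so [R 0 Y Z W] vanishes. *)
have := l Y Z W (-1) 0 0; rewrite scaler0 !addr0 => h0 ->.
lra.
Qed.

Lemma act_opp1 (X Y Z W : V) : R (- X) Y Z W = - R X Y Z W.
Proof. by rewrite -scaleN1r act_scale1 mulN1r. Qed.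

(** Antisymmetry carries linearity from slot 1 to slot 2, and pair symmetry carries it on to slots 3
    and 4. *)
Lemma act_add2 (X Y Y' Z W : V) : R X (Y + Y') Z W = R X Y Z W + R X Y' Z W.
Proof. by rewrite !(act_antisym12 curvR X) act_add1 opprD. Qed.

Lemma act_add3 (X Y Z Z' W : V) : R X Y (Z + Z') W = R X Y Z W + R X Y Z' W.
Proof. by rewrite !(act_pair_sym curvR X) act_add1. Qed.

Lemma act_add4 (X Y Z W W' : V) : R X Y Z (W + W') = R X Y Z W + R X Y Z W'.
Proof. by rewrite !(act_pair_sym curvR X) act_add2. Qed.

Lemma act_scale2 (c : K) (X Y Z W : V) : R X (c *: Y) Z W = c * R X Y Z W.
Proof. by rewrite !(act_antisym12 curvR X) act_scale1 mulrN. Qed.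

Lemma act_scale3 (c : K) (X Y Z W : V) : R X Y (c *: Z) W = c * R X Y Z W.
Proof. by rewrite !(act_pair_sym curvR X) act_scale1. Qed.

Lemma act_scale4 (c : K) (X Y Z W : V) : R X Y Z (c *: W) = c * R X Y Z W.
Proof. by rewrite !(act_pair_sym curvR X) act_scale2. Qed.

Lemma act_opp2 (X Y Z W : V) : R X (- Y) Z W = - R X Y Z W.
Proof. by rewrite -scaleN1r act_scale2 mulN1r. Qed.

Lemma act_opp3 (X Y Z W : V) : R X Y (- Z) W = - R X Y Z W.
Proof. by rewrite -scaleN1r act_scale3 mulN1r. Qed.

Lemma act_opp4 (X Y Z W : V) : R X Y Z (- W) = - R X Y Z W.
Proof. by rewrite -scaleN1r act_scale4 mulN1r. Qed.

Lemma act_alt12 (X Z W : V) : R X X Z W = 0.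
Proof. by have := act_antisym12 curvR X X Z W; lra. Qed.

Lemma act_alt34 (X Y Z : V) : R X Y Z Z = 0.
Proof. by rewrite (act_pair_sym curvR) act_alt12. Qed.

(** Removes the irrational factor of the mixed frame from all four slots at once, leaving rational
    coefficients for [lra]. *)
Lemma act_scale_all (c : K) (X Y Z W : V) : c * c = 2^-1 ->
  R (c *: X) (c *: Y) (c *: Z) (c *: W) = 4^-1 * R X Y Z W.
Proof.
move=> cc; rewrite act_scale1 act_scale2 act_scale3 act_scale4.
by rewrite !mulrA cc -(mulrA 2^-1 c c) cc; lra.
Qed.

Definition act_additive :=
  (act_add1, act_add2, act_add3, act_add4,
   act_opp1, act_opp2, act_opp3, act_opp4).

(** This is [hR] on the frame f of [orthonormal4_mix]. There f13 = e14 and f24 = -e23; f12 and f34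
    are half of (e12 + e34) ± (e13 + e24); f14 and f23 are half of ±(e12 - e34) - (e13 - e24). Cross
    terms cancel within each of the last two pairs. *)
Lemma mixed_frame_curvature (g : {dot V for idfun}) (e1 e2 e3 e4 : V) :
  (forall f1 f2 f3 f4 : V, orthonormal g [:: f1; f2; f3; f4] ->
     R f1 f3 f1 f3 + R f1 f4 f1 f4 + R f2 f3 f2 f3 + R f2 f4 f2 f4
       > 2^-1 * (R f1 f2 f1 f2 + R f3 f4 f3 f4)) ->
  orthonormal g [:: e1; e2; e3; e4] ->
  R e1 e4 e1 e4 + R e2 e3 e2 e3
    + 4^-1 * (R e1 e2 e1 e2 + R e3 e4 e3 e4 + R e1 e3 e1 e3 + R e2 e4 e2 e4)
  > 3 / 2 * (R e1 e2 e3 e4 + R e1 e3 e2 e4).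
Proof.
move=> hR on; pose c : K := Num.sqrt 2^-1.
have cc : c * c = 2^-1 by rewrite -expr2 sqr_sqrtr // invr_ge0 ler0n.
have := hR _ _ _ _ (orthonormal4_mix cc on).
rewrite !(act_scale_all _ _ _ _ cc) !act_additive !(act_alt12, act_alt34).
(* Sorting the indices turns equal curvature entries into the same atom for [lra]. *)
rewrite !(act_antisym12 curvR e2 e1) !(act_antisym12 curvR e3 e1).
rewrite !(act_antisym12 curvR e4 e1) !(act_antisym12 curvR e3 e2).
rewrite !(act_antisym12 curvR e4 e2) !(act_antisym12 curvR e4 e3).
rewrite !(act_antisym34 curvR _ _ e2 e1) !(act_antisym34 curvR _ _ e3 e1).
rewrite !(act_antisym34 curvR _ _ e4 e1) !(act_antisym34 curvR _ _ e3 e2).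
rewrite !(act_antisym34 curvR _ _ e4 e2) !(act_antisym34 curvR _ _ e4 e3).
rewrite !(act_pair_sym curvR e3 e4 e1 e2) !(act_pair_sym curvR e2 e4 e1 e3).
lra.
Qed.

End CurvatureTensor.

Theorem theorem1p2 (K : realType) (V : vectType K) (g : {dot V for idfun})
    (R : V -> V -> V -> V -> K)
    (dimV : (4 <= \dim {:V})%N)
    (curvR : algebraic_curvature_tensor R)
    (hR : forall e1 e2 e3 e4 : V, orthonormal g [:: e1; e2; e3; e4] ->
       R e1 e3 e1 e3 + R e1 e4 e1 e4 + R e2 e3 e2 e3 + R e2 e4 e2 e4
         > 2^-1 * (R e1 e2 e1 e2 + R e3 e4 e3 e4)) :
  positive_isotropic_curvature g R.
Proof.
move=> e1 e2 e3 e4 on.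
have h0 := hR _ _ _ _ on.
have h1 := mixed_frame_curvature curvR hR on.
(* Here v is along e14 - e23; it was along e12 - e34 in [h0] and e13 + e24 in [h1]. *)
have := mixed_frame_curvature curvR hR (orthonormal4_turn on).
rewrite !(act_additive curvR).
rewrite (act_antisym12 curvR e4 e3) !(act_antisym34 curvR _ _ e4 e3).
rewrite (act_antisym34 curvR e1 e4 e2 e3).
(* Bianchi reads R1324 - R1423 = R1234, so the plain sum of the three inequalities is 9/4 (R1313 +
   R1414 + R2323 + R2424) > 9/2 R1234. *)
have := act_bianchi curvR e1 e2 e3 e4.
rewrite (act_antisym34 curvR e1 e3 e4 e2) (act_antisym34 curvR e1 e4 e3 e2).
lra.
Qed.
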